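(* Let $n$ be a positive integer. The Diophantine equation $$1+F_nx+F_{n+1}y=\frac{(F_n-1)(F_{n+1}-1)}{5}$$ has a solution in nonnegative integers $x,y$ if and only if $n\equiv 7\pmod{20}$ or $n\equiv 8\pmod{20}$. More precisely, if $n\equiv 7\pmod{20}$, then the nonnegative integral solution is $$(x,y)=\left(\frac{3F_{n+1}-4F_n-1}{5},\ \frac{4F_{n-1}-2F_n-1}{5}\right),$$ whereas if $n\equiv 8\pmod{20}$, then the nonnegative integral solution is $$(x,y)=\left(\frac{4F_n-2F_{n+1}-1}{5},\ \frac{3F_n-4F_{n-1}-1}{5}\right).$$
   Context: $(F_n)$ is the Fibonacci sequence with $F_1=F_2=1$ and $F_n=F_{n-1}+F_{n-2}$ for all $n\in\mathbb{Z}$. *)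

(* Defs.v *)
From HB Require Import structures.
From mathcomp Require Import all_boot all_order all_algebra.
Set Implicit Arguments.
Unset Strict Implicit.
Unset Printing Implicit Defensive.
Import GRing.Theory.
Local Open Scope ring_scope.

(* F_0 = 0, the value forced by F_1 = F_2 = 1 and F_2 = F_1 + F_0. *)
Fixpoint fib (n : nat) : nat :=
  match n with
  | 0%N => 0%N
  | 1%N => 1%N
  | (m.+1 as p).+1 => (fib p + fib m)%N
  end.

(* Rational-valued, so that subtraction is not truncated and division by 5 is
   exact. *)
Definition fibQ (n : nat) : rat := (fib n)%:R.

Definition dioph_eq (n x y : nat) : Prop :=
  1 + fibQ n * x%:R + fibQ n.+1 * y%:R
  = (fibQ n - 1) * (fibQ n.+1 - 1) / 5%:R.

(* Main.v *)
Require Import Defs.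
From HB Require Import structures.
From mathcomp Require Import all_boot all_order all_algebra.
From mathcomp Require Import zify lra.
Set Implicit Arguments.
Unset Strict Implicit.
Unset Printing Implicit Defensive.
Import GRing.Theory.
Local Open Scope ring_scope.

(** Write a = F_n and b = F_(n+1).  Clearing the denominator, the equation says
    that X = 5x+1 and Y = 5y+1 satisfy aX + bY = ab - 4.  As a and b are coprime
    and Y > 0 forces X < b, there is at most one such pair (X, Y)
    ([coprime_comb_inj]).  Cassini's identity b^2 - ab - a^2 = (-1)^n
    ([fib_cassini]) exhibits, for n >= 3, the only possible pair: it is
    (3b - 4a, 4b - 6a) when n is odd and (4a - 2b, 7a - 4b) when n is even
    ([fib_comb_sol]).  So the equation is solvable exactly when both entries of
    this pair are 1 modulo 5 ([dioph_eq_solE]), which means (a, b) = (3, 1) for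
    odd n and (a, b) = (1, 4) for even n, modulo 5; for n = 1 and n = 2 there is no
    solution, since ab < 4.  Since the Fibonacci sequence
    has period 20 modulo 5, a check of the twenty residues shows that these pairs
    occur exactly at n = 7 and n = 8 modulo 20 ([fib_mod5_7], [fib_mod5_8]). *)

Lemma fibSS n : fib n.+2 = (fib n.+1 + fib n)%N.
Proof. by []. Qed.

Lemma coprime_fibS n : coprime (fib n) (fib n.+1).
Proof.
elim: n => [//|n IHn].
by rewrite fibSS coprime_sym /coprime gcdnC gcdnDl gcdnC.
Qed.

Lemma fib_cassini n :
  (fib n.+1 * fib n.+1 + odd n = fib n * fib n.+1 + fib n * fib n + ~~ odd n)%N.
Proof.
elim: n => [//|n IHn].
by move: IHn; rewrite fibSS /=; case: (odd n) => /=; nia.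
Qed.

(** Rational bounds around the golden ratio: 3/2 <= F_(n+1) / F_n <= 7/4 for n >= 3. *)
Lemma fib_ratio_bounds n : (3 <= n)%N ->
  [/\ 0 < fib n, 3 * fib n <= 2 * fib n.+1 & 4 * fib n.+1 <= 7 * fib n]%N.
Proof.
elim: n => [//|n IHn]; rewrite leq_eqVlt => /orP[/eqP <- //|].
by rewrite ltnS => /IHn[h1 h2 h3]; rewrite fibSS; split; lia.
Qed.

Lemma coprime_comb_inj a b u v u' v' :
  coprime a b -> (u < b)%N -> (u' < b)%N ->
  (a * u + b * v = a * u' + b * v')%N -> u = u' /\ v = v'.
Proof.
move=> cab; wlog le_uu' : u v u' v' / (u <= u')%N => [hw ub ub' e|ub ub' e].
  have [le_uu'|/ltnW le_u'u] := leqP u u'; first exact: hw e.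
  by case: (hw u' v' u v le_u'u ub' ub (esym e)).
have eD : (a * (u' - u) = b * (v - v'))%N by nia.
have : (b %| u' - u)%N.
  by rewrite -(@Gauss_dvdr _ a) 1?coprime_sym // eD dvdn_mulr.
have [/eqP|u'_gt0 /(dvdn_leq u'_gt0)] := posnP (u' - u)%N; last by lia.
rewrite subn_eq0 => le_u'u _.
have eu : u = u' by lia.
by split=> //; subst u'; nia.
Qed.

(** The pair [(fib_solX n, fib_solY n)] is the representation of F_n F_(n+1) - 4
    as a combination of F_n and F_(n+1); for n >= 3 the subtractions are not
    truncated, by [fib_ratio_bounds]. *)
Definition fib_solX n : nat :=
  (if odd n then 3 * fib n.+1 - 4 * fib n else 4 * fib n - 2 * fib n.+1)%N.

Definition fib_solY n : nat :=
  (if odd n then 4 * fib n.+1 - 6 * fib n else 7 * fib n - 4 * fib n.+1)%N.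

Lemma fib_comb_sol n : (3 <= n)%N ->
  (fib n * fib_solX n + fib n.+1 * fib_solY n + 4 = fib n * fib n.+1)%N.
Proof.
move=> /fib_ratio_bounds[h1 h2 h3]; have := fib_cassini n.
rewrite /fib_solX /fib_solY; move: (fib n) (fib n.+1) h1 h2 h3 => a b h1 h2 h3.
by case: (odd n) => /= hC; nia.
Qed.

Lemma fib_solX_lt n : (3 <= n)%N -> (fib_solX n < fib n.+1)%N.
Proof.
move=> /fib_ratio_bounds[h1 h2 h3]; rewrite /fib_solX.
by case: (odd n); lia.
Qed.

Lemma dioph_eqE n x y : dioph_eq n x y <->
  (fib n * (5 * x + 1) + fib n.+1 * (5 * y + 1) + 4 = fib n * fib n.+1)%N.
Proof.
rewrite /dioph_eq /fibQ; set a := fib n; set b := fib n.+1.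
split=> [e|/(congr1 (fun m => m%:R : rat))]; last first.
  by rewrite !(natrD, natrM) => e; lra.
by apply/eqP; rewrite -(Num.Theory.eqr_nat rat) !(natrD, natrM); apply/eqP; lra.
Qed.

Lemma dioph_eq_solE n x y : (0 < n)%N -> dioph_eq n x y <->
  [/\ (3 <= n)%N, fib_solX n = (5 * x + 1)%N & fib_solY n = (5 * y + 1)%N].
Proof.
move=> n_gt0; rewrite dioph_eqE; split=> [e|[n_ge3 <- <-]]; last first.
  exact: fib_comb_sol.
(* For n = 1 and n = 2 the right-hand side is smaller than 4. *)
have n_ge3 : (3 <= n)%N by move: n n_gt0 e => [|[|[|n]]] //=; lia.
have [a_gt0 _ _] := fib_ratio_bounds n_ge3.
have x_lt : (5 * x + 1 < fib n.+1)%N by nia.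
have eC := fib_comb_sol n_ge3.
have eXY : (fib n * fib_solX n + fib n.+1 * fib_solY n
            = fib n * (5 * x + 1) + fib n.+1 * (5 * y + 1))%N by lia.
by have [] := coprime_comb_inj (coprime_fibS n) (fib_solX_lt n_ge3) x_lt eXY.
Qed.

Lemma fib_add20_mod5 n : (fib (n + 20) = fib n %[mod 5])%N.
Proof.
(* F_(n+20) = F_20 F_(n+1) + F_19 F_n, with F_20 = 5 * 1353, F_19 = 5 * 836 + 1. *)
have -> : (fib (n + 20) = 5 * (1353 * fib n.+1 + 836 * fib n) + fib n)%N.
  by rewrite addnC !addSn add0n !fibSS; lia.
by rewrite mulnC modnMDl.
Qed.

Lemma fib_mod5_mod20 n : (fib n = fib (n %% 20) %[mod 5])%N.
Proof.
rewrite {1}(divn_eq n 20); elim: (n %/ 20)%N => [//|q IHq].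
by rewrite mulSn -addnA addnC fib_add20_mod5.
Qed.

Lemma fibS_mod5_mod20 n : (fib n.+1 = fib (n %% 20).+1 %[mod 5])%N.
Proof. by rewrite fib_mod5_mod20 -addn1 -modnDml addn1 -fib_mod5_mod20. Qed.

Lemma fib_mod5_eqE n c d : (fib n %% 5 == c)%N && (fib n.+1 %% 5 == d)%N =
  (n %% 20 \in [seq r <- iota 0 20 | (fib r %% 5 == c) && (fib r.+1 %% 5 == d)])%N.
Proof.
rewrite mem_filter mem_iota /= add0n ltn_pmod // andbT.
by rewrite -fib_mod5_mod20 -fibS_mod5_mod20.
Qed.

Lemma fib_mod5_7 n :
  (fib n %% 5 == 3)%N && (fib n.+1 %% 5 == 1)%N = (n %% 20 == 7)%N.
Proof. by rewrite fib_mod5_eqE -mem_seq1; congr (_ \in _). Qed.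

Lemma fib_mod5_8 n :
  (fib n %% 5 == 1)%N && (fib n.+1 %% 5 == 4)%N = (n %% 20 == 8)%N.
Proof. by rewrite fib_mod5_eqE -mem_seq1; congr (_ \in _). Qed.

Lemma dioph_eq_mod20 n x y : (0 < n)%N -> dioph_eq n x y ->
  (n = 7 %[mod 20])%N \/ (n = 8 %[mod 20])%N.
Proof.
move=> n_gt0 /(dioph_eq_solE _ _ n_gt0)[_]; rewrite /fib_solX /fib_solY.
case: (odd n) => eX eY; [left | right]; apply/eqP.
- by rewrite -fib_mod5_7; apply/andP; split; apply/eqP; lia.
- by rewrite -fib_mod5_8; apply/andP; split; apply/eqP; lia.
Qed.

Lemma dioph_eq_unique n x y x' y' : (0 < n)%N ->
  dioph_eq n x y -> dioph_eq n x' y' -> x' = x /\ y' = y.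
Proof.
move=> n_gt0 /(dioph_eq_solE _ _ n_gt0)[_ eX eY].
by move=> /(dioph_eq_solE _ _ n_gt0)[_ eX' eY']; lia.
Qed.

Lemma fibQ_succ n : (0 < n)%N -> fibQ n.+1 = fibQ n + fibQ n.-1.
Proof. by case: n => // n _; rewrite /fibQ fibSS natrD. Qed.

Lemma dioph_eq_sol_mod7 n : (n = 7 %[mod 20])%N ->
  exists x y : nat,
    [/\ x%:R = (3%:R * fibQ n.+1 - 4%:R * fibQ n - 1) / 5%:R,
        y%:R = (4%:R * fibQ n.-1 - 2%:R * fibQ n - 1) / 5%:R
      & dioph_eq n x y].
Proof.
move=> n7; have n_ge3 : (3 <= n)%N by lia.
have n_gt0 : (0 < n)%N by lia.
have on : odd n by lia.
have /andP[/eqP a5 /eqP b5] : (fib n %% 5 == 3)%N && (fib n.+1 %% 5 == 1)%N.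
  by rewrite fib_mod5_7; apply/eqP.
have [h1 h2 h3] := fib_ratio_bounds n_ge3.
pose x := (fib_solX n %/ 5)%N; pose y := (fib_solY n %/ 5)%N.
have eX : (3 * fib n.+1 = 5 * x + 1 + 4 * fib n)%N.
  by rewrite /x /fib_solX on; lia.
have eY : (4 * fib n.+1 = 5 * y + 1 + 6 * fib n)%N.
  by rewrite /y /fib_solY on; lia.
have := congr1 (fun m => m%:R : rat) eX; have := congr1 (fun m => m%:R : rat) eY.
rewrite /= !(natrD, natrM) -!/(fibQ _) => eYQ eXQ.
have eF := fibQ_succ n_gt0.
exists x, y; split; [lra | lra | apply/(dioph_eq_solE _ _ n_gt0)].
by split=> //; rewrite /fib_solX /fib_solY on; lia.
Qed.

Lemma dioph_eq_sol_mod8 n : (n = 8 %[mod 20])%N ->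
  exists x y : nat,
    [/\ x%:R = (4%:R * fibQ n - 2%:R * fibQ n.+1 - 1) / 5%:R,
        y%:R = (3%:R * fibQ n - 4%:R * fibQ n.-1 - 1) / 5%:R
      & dioph_eq n x y].
Proof.
move=> n8; have n_ge3 : (3 <= n)%N by lia.
have n_gt0 : (0 < n)%N by lia.
have /negbTE on : ~~ odd n by lia.
have /andP[/eqP a5 /eqP b5] : (fib n %% 5 == 1)%N && (fib n.+1 %% 5 == 4)%N.
  by rewrite fib_mod5_8; apply/eqP.
have [h1 h2 h3] := fib_ratio_bounds n_ge3.
pose x := (fib_solX n %/ 5)%N; pose y := (fib_solY n %/ 5)%N.
have eX : (4 * fib n = 5 * x + 1 + 2 * fib n.+1)%N.
  by rewrite /x /fib_solX on; lia.
have eY : (7 * fib n = 5 * y + 1 + 4 * fib n.+1)%N.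
  by rewrite /y /fib_solY on; lia.
have := congr1 (fun m => m%:R : rat) eX; have := congr1 (fun m => m%:R : rat) eY.
rewrite /= !(natrD, natrM) -!/(fibQ _) => eYQ eXQ.
have eF := fibQ_succ n_gt0.
exists x, y; split; [lra | lra | apply/(dioph_eq_solE _ _ n_gt0)].
by split=> //; rewrite /fib_solX /fib_solY on; lia.
Qed.

Theorem proposition3p3 (n : nat) (n_gt0 : (0 < n)%N) :
  [/\ (exists x y : nat, dioph_eq n x y) <->
        (n = 7 %[mod 20])%N \/ (n = 8 %[mod 20])%N,
      (n = 7 %[mod 20])%N ->
        exists x y : nat,
          [/\ x%:R = (3%:R * fibQ n.+1 - 4%:R * fibQ n - 1) / 5%:R,
              y%:R = (4%:R * fibQ n.-1 - 2%:R * fibQ n - 1) / 5%:R,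
              dioph_eq n x y &
              forall x' y' : nat, dioph_eq n x' y' -> x' = x /\ y' = y]
    & (n = 8 %[mod 20])%N ->
        exists x y : nat,
          [/\ x%:R = (4%:R * fibQ n - 2%:R * fibQ n.+1 - 1) / 5%:R,
              y%:R = (3%:R * fibQ n - 4%:R * fibQ n.-1 - 1) / 5%:R,
              dioph_eq n x y &
              forall x' y' : nat, dioph_eq n x' y' -> x' = x /\ y' = y]].
Proof.
split=> [|n7|n8].
- split=> [[x [y /(dioph_eq_mod20 n_gt0)]] //|].
  by case=> [/dioph_eq_sol_mod7|/dioph_eq_sol_mod8] [x [y [_ _ e]]]; exists x, y.
- have [x [y [ex ey e]]] := dioph_eq_sol_mod7 n7.
  by exists x, y; split=> // x' y'; apply: dioph_eq_unique e.
- have [x [y [ex ey e]]] := dioph_eq_sol_mod8 n8.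
  by exists x, y; split=> // x' y'; apply: dioph_eq_unique e.
Qed.
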